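(* Let $A:\mathbb{R}^n\to\mathbb{R}^n$ be a linear operator that is generalized strictly sign-regular (GSSR) with respect to a totally positive structure $\{K_1,\ldots,K_n\}$. Then for every $j=1,\ldots,n$ the interior of $T(K_j)$ is nonempty and $$A\big(T(K_j)\setminus\{0\}\big)\subseteq\operatorname{int}(T(K_j)).$$
   Context: A proper cone in a finite-dimensional real space is a closed convex cone that is pointed ($K\cap(-K)=\{0\}$) and solid ($\operatorname{int}K\ne\emptyset$). $\wedge^j\mathbb{R}^n$ is the $j$th exterior power of $\mathbb{R}^n$, and for a linear operator $A$ on $\mathbb{R}^n$, $\wedge^jA$ is the operator on $\wedge^j\mathbb{R}^n$ with $(\wedge^jA)(x_1\wedge\cdots\wedge x_j)=Ax_1\wedge\cdots\wedge Ax_j$ ($\wedge^1A=A$). A linear operator $B$ is $K$-positive if $B(K\setminus\{0\})\subseteq\operatorname{int}(K)$. A totally positive structure on $\mathbb{R}^n$ is a family $\{K_1,\ldots,K_n\}$ with $K_j\subset\wedge^j\mathbb{R}^n$ a proper cone. $A$ is GSSR with respect to it if there are $\epsilon_1,\ldots,\epsilon_n\in\{1,-1\}$ such that $\epsilon_j\wedge^jA$ is $K_j$-positive for every $j=1,\ldots,n$. Define $T(K_1)=K_1\cup(-K_1)$, and for $j\ge2$ let $T(K_j)$ be the closure of the set of all $x_1\in\mathbb{R}^n$ for which there exist $x_2,\ldots,x_j\in\mathbb{R}^n$ with $x_1\wedge x_2\wedge\cdots\wedge x_j\in\operatorname{int}(K_j)\cup\operatorname{int}(-K_j)$. *)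

(* Defs.v *)
From HB Require Import structures.
From mathcomp Require Import all_boot all_order all_algebra.
From mathcomp Require Import all_classical all_reals all_analysis.
Set Implicit Arguments. Unset Strict Implicit. Unset Printing Implicit Defensive.
Import Order.TTheory GRing.Theory Num.Theory.
Import numFieldNormedType.Exports.
Local Open Scope classical_set_scope.
Local Open Scope ring_scope.

(* Concrete model of the exterior power: wedge^j R^n is identified with
   R^{C(n,j)} via Pluecker coordinates, coordinates indexed by the
   j-element subsets of 'I_n. *)
Definition ksub (n j : nat) := {S : {set 'I_n} | #|S| == j}.
Definition wdim (n j : nat) := #|{: ksub n j}|.

(* the increasingly ordered enumeration of a j-subset: 'I_j -> 'I_n *)
Definition ksub_fun n j (s : ksub n j) (i : 'I_j) : 'I_n :=
  @enum_val _ (mem (val s)) (cast_ord (esym (eqP (valP s))) i).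

(* x_1 /\ ... /\ x_j, where the x_k are the columns of X *)
Definition wedge (R : realType) n j (X : 'M[R]_(n, j)) : 'cV[R]_(wdim n j) :=
  \col_(k < wdim n j) \det (rowsub (ksub_fun (enum_val k)) X).

Definition compound (R : realType) n j (A : 'M[R]_n) : 'M[R]_(wdim n j) :=
  \matrix_(k < wdim n j, l < wdim n j)
     \det (mxsub (ksub_fun (enum_val k)) (ksub_fun (enum_val l)) A).

Definition closed_convex_cone (R : realType) m (K : set 'cV[R]_m) :=
  [/\ closed K, K 0,
      (forall x y, K x -> K y -> K (x + y)) &
      (forall (a : R) x, 0 <= a -> K x -> K (a *: x))].

Definition proper_cone (R : realType) m (K : set 'cV[R]_m) :=
  [/\ closed_convex_cone K,
      K `&` [set - x | x in K] = [set 0] &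
      interior K !=set0].

Definition K_positive (R : realType) m (B : 'M[R]_m) (K : set 'cV[R]_m) :=
  forall x, K x -> x != 0 -> interior K (B *m x).

Definition TP_structure (R : realType) n
  (K : forall j : nat, set 'cV[R]_(wdim n j)) :=
  forall j, (1 <= j <= n)%N -> proper_cone (K j).

Definition GSSR (R : realType) n (A : 'M[R]_n)
  (K : forall j : nat, set 'cV[R]_(wdim n j)) :=
  exists eps : nat -> R, forall j, (1 <= j <= n)%N ->
    (eps j = 1 \/ eps j = -1) /\ K_positive (eps j *: compound j A) (K j).

Definition neg_set (R : realType) m (K : set 'cV[R]_m) := [set - x | x in K].

(* T(K_j) as a subset of R^n (only meaningful for 1 <= j; T(K_0) is unused) *)
Definition TK (R : realType) n j (K : set 'cV[R]_(wdim n j)) : set 'cV[R]_n :=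
  match j return set 'cV[R]_(wdim n j) -> set 'cV[R]_n with
  | 0 => fun _ => set0
  | 1 => fun K => [set x | (K `|` neg_set K) (wedge x)]
  | j'.+2 => fun K => closure [set x | exists X : 'M[R]_(n, j'.+2),
            col 0 X = x /\ (interior K `|` interior (neg_set K)) (wedge X)]
  end K.

(* Main.v *)
(** Let [U] be the set of [w] such that [w] or [- w] is interior to [K_j].  The
    set of first columns of matrices [X] with [wedge X] in [U] is open.  Every
    nonzero [x] in its closure is the first column of some [Z] with [wedge Z] a
    nonzero element of [K_j `|` -K_j]: dividing a full-rank [X] on the right by
    a [j x j] submatrix of maximal determinant gives a matrix with entries in
    [[-1, 1]] and an identity submatrix, and such matrices form a compact set.
    By Cauchy-Binet and positivity of the compound matrix, [wedge (A *m Z)] lies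
    in [U], so [A *m x] is interior to [T(K_j)].

    That [U] contains a decomposable vector needs no Perron eigenvector.  Let
    [B] be [K]-positive and [p] interior to [K].  As long as neither [B v] nor
    [- B v] is interior, [-u <= v <= u] implies [-q B u <= B v <= q B u] with a
    uniform [|q| < 1].  If no iterate of a basis vector of the exterior power
    (which is decomposable) entered [U], all of them would be negligible against
    [B^N p], although [B^N p] is a fixed linear combination of them. *)

Require Import Defs.
From mathcomp Require Import all_boot all_order all_algebra.
From mathcomp Require Import perm ring lra.
From mathcomp Require Import all_classical all_reals all_analysis.
Set Implicit Arguments.
Unset Strict Implicit.
Unset Printing Implicit Defensive.
Import Order.TTheory GRing.Theory Num.Theory.
Import numFieldNormedType.Exports.
Local Open Scope classical_set_scope.
Local Open Scope ring_scope.

(** * Cauchy-Binet and exterior powers *)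

Lemma ksub_fun_inj n j (s : ksub n j) : injective (ksub_fun s).
Proof. by move=> i k /enum_val_inj /cast_ord_inj. Qed.

Lemma imset_ksub_fun n j (s : ksub n j) : (ksub_fun s @: 'I_j)%SET = val s.
Proof.
apply/eqP; rewrite eqEcard card_imset ?card_ord; last exact: ksub_fun_inj.
rewrite (eqP (valP s)) leqnn andbT; apply/fintype.subsetP => _ /imsetP[i _ ->].
exact: (@enum_valP _ (mem (val s))).
Qed.

Lemma mem_ksubP n j (s : ksub n j) x :
  reflect (exists i, x = ksub_fun s i) (x \in val s).
Proof.
by rewrite -imset_ksub_fun; apply: (iffP imsetP) => [[i _]|[i]]; exists i.
Qed.

Lemma card_imset_ord n j (f : 'I_j -> 'I_n) :
  injective f -> #|(f @: 'I_j)%SET| == j.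
Proof. by move=> f_inj; rewrite card_imset ?card_ord. Qed.

Lemma wdim_gt0 n j : (j <= n)%N -> (0 < wdim n j)%N.
Proof.
move=> jn; have widen_inj : injective (widen_ord jn).
  by move=> i k /(congr1 val) /= /val_inj.
pose s : ksub n j := Sub (widen_ord jn @: 'I_j)%SET (card_imset_ord widen_inj).
by apply/card_gt0P; exists s.
Qed.

Lemma inj_ksub_fun_perm n j (f : 'I_j -> 'I_n) :
  injective f -> exists (s : ksub n j) (p : 'S_j), f =1 ksub_fun s \o p.
Proof.
move=> f_inj; pose s : ksub n j := Sub (f @: 'I_j)%SET (card_imset_ord f_inj).
have /all_sig[g fE] i : {k | f i = ksub_fun s k}.
  by apply/cid/mem_ksubP/imset_f.
have g_inj : injective g.
  by move=> i k /(congr1 (ksub_fun s)); rewrite -!fE => /f_inj.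
by exists s, (perm g_inj) => i; rewrite /= permE.
Qed.

Lemma ksub_fun_perm_inj n j (s t : ksub n j) (p q : 'S_j) :
  ksub_fun s \o p =1 ksub_fun t \o q -> s = t /\ p = q.
Proof.
move=> spE; have st : s = t.
  apply/val_inj; rewrite -2!imset_ksub_fun.
  have imperm (u : ksub n j) (r : 'S_j) :
      (ksub_fun u @: 'I_j)%SET = ((ksub_fun u \o r) @: 'I_j)%SET.
    apply/setP => x; apply/imsetP/imsetP => -[i _ ->]; last by exists (r i).
    by exists ((r^-1)%g i); rewrite //= permKV.
  by rewrite (imperm s p) (imperm t q); apply: eq_imset.
by subst t; split=> //; apply/permP => i; apply: ksub_fun_inj (spE i).
Qed.

Lemma det_mulmx_sum_rowsub (R : comNzRingType) n j
    (M : 'M[R]_(j, n)) (X : 'M[R]_(n, j)) :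
  \det (M *m X) =
    \sum_(f : {ffun 'I_j -> 'I_n}) (\prod_i M i (f i)) * \det (rowsub f X).
Proof.
rewrite /determinant.
under eq_bigr => p _.
  under eq_bigr => i _ do rewrite mxE.
  rewrite bigA_distr_bigA big_distrr /=; over.
rewrite exchange_big /=; apply: eq_bigr => f _.
rewrite big_distrr /=; apply: eq_bigr => p _.
rewrite big_split /= mulrCA; congr (_ * (_ * _)).
by apply: eq_bigr => i _; rewrite mxE.
Qed.

Lemma det_rowsub_noninjective (R : comNzRingType) n j (f : 'I_j -> 'I_n)
  (X : 'M[R]_(n, j)) : ~~ injectiveb f -> \det (rowsub f X) = 0.
Proof.
move=> /injectivePn [i [k ik fik]].
by apply: (determinant_alternate ik) => l; rewrite !mxE fik.
Qed.

Lemma sum_injective_ffun (V : nmodType) n j (F : {ffun 'I_j -> 'I_n} -> V) :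
  \sum_(f : {ffun 'I_j -> 'I_n} | injectiveb f) F f =
    \sum_(s : ksub n j) \sum_(p : 'S_j) F [ffun i => ksub_fun s (p i)].
Proof.
pose arrange (sp : ksub n j * 'S_j) := [ffun i => ksub_fun sp.1 (sp.2 i)].
have arrange_inj : injective arrange.
  move=> [s p] [t q] /ffunP eq_st.
  have [|-> -> //] := @ksub_fun_perm_inj _ _ s t p q.
  by move=> i; have := eq_st i; rewrite !ffunE.
have codom_arrange f : (f \in (arrange @: predT)%SET) = injectiveb f.
  apply/imsetP/injectiveP => [[[s p] _ ->] i k|/inj_ksub_fun_perm[s [p fE]]].
    by rewrite !ffunE => /ksub_fun_inj/perm_inj.
  by exists (s, p) => //; apply/ffunP => i; rewrite ffunE fE.
rewrite -(eq_bigl _ _ codom_arrange) big_imset /=.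
  by rewrite pair_big; apply: eq_bigr.
by move=> ? ? _ _ /arrange_inj.
Qed.

Lemma Cauchy_Binet (R : comNzRingType) n j
    (M : 'M[R]_(j, n)) (X : 'M[R]_(n, j)) :
  \det (M *m X) = \sum_(s : ksub n j)
     \det (colsub (ksub_fun s) M) * \det (rowsub (ksub_fun s) X).
Proof.
rewrite det_mulmx_sum_rowsub (bigID (fun f : {ffun _} => injectiveb f)) /=.
rewrite [X in _ + X]big1 => [|f /det_rowsub_noninjective ->]; last exact: mulr0.
rewrite addr0 sum_injective_ffun; apply: eq_bigr => s _.
rewrite [\det (colsub _ _)]/determinant big_distrl /=; apply: eq_bigr => p _.
have -> : rowsub [ffun i => ksub_fun s (p i)] X =
    row_perm p (rowsub (ksub_fun s) X).
  by apply/matrixP => i k; rewrite !mxE ffunE.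
rewrite row_permE det_mulmx det_perm mulrA [_ * (-1) ^+ _]mulrC.
by congr (_ * _ * _); apply: eq_bigr => i _; rewrite !mxE ffunE.
Qed.

Lemma row_full_unit_rowsubP (F : fieldType) n j (X : 'M[F]_(n, j)) :
  reflect (exists f : {ffun 'I_j -> 'I_n}, rowsub f X \in unitmx) (row_full X).
Proof.
apply: (iffP idP) => [Xfull|[f fX]].
  by exists (fullrankfun Xfull); apply: fullrowsub_unit.
apply/row_fullP; exists (invmx (rowsub f X) *m rowsub f 1%:M).
by rewrite -mulmxA -rowsubE mulVmx.
Qed.

(* Choose [f] with [|det (rowsub f X)|] maximal: by Cramer's rule the entries of
   the product are quotients of such determinants by the maximal one. *)
Lemma maximal_minor_bound (R : realFieldType) n j (X : 'M[R]_(n, j)) :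
  row_full X -> exists2 f : {ffun 'I_j -> 'I_n},
    rowsub f X \in unitmx & forall i k, `|(X *m invmx (rowsub f X)) i k| <= 1.
Proof.
move=> /row_full_unit_rowsubP[f0 f0X].
pose minor (f : {ffun 'I_j -> 'I_n}) := `|\det (rowsub f X)|.
have minor_unit f : (0 < minor f) = (rowsub f X \in unitmx).
  by rewrite normr_gt0 unitmxE unitfE.
have [f _ f_max] := @arg_maxP _ _ _ f0 predT minor isT.
have f_unit : rowsub f X \in unitmx.
  by rewrite -minor_unit (lt_le_trans _ (f_max f0 isT)) ?minor_unit.
exists f => // i l; rewrite /invmx f_unit -scalemxAr mxE normrM normfV.
rewrite mulrC ler_pdivrMr ?mul1r -/(minor f) ?minor_unit //.
pose g : {ffun 'I_j -> 'I_n} := [ffun q => if q == l then i else f q].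
suff -> : (X *m \adj (rowsub f X)) i l = \det (rowsub g X) by apply: f_max.
rewrite (expand_det_row _ l) mxE; apply: eq_bigr => q _.
rewrite !mxE ffunE eqxx /cofactor; congr (_ * (_ * \det _)).
by apply/matrixP => a b; rewrite !mxE ffunE eq_sym (negbTE (neq_lift _ _)).
Qed.

Lemma exists_unitmx_col0 (F : fieldType) j (c : 'cV[F]_j.+1) :
  c != 0 -> exists2 G : 'M[F]_j.+1, G \in unitmx & col 0 G = c.
Proof.
move=> c0; pose e : 'rV[F]_j.+1 := delta_mx 0 0.
have eE : e *m (c *m e)^T = c^T.
  rewrite trmx_mul mulmxA /e trmx_delta mul_delta_mx [delta_mx _ _]mx11_scalar.
  by rewrite mxE !eqxx mul1mx.
have [|G G_unit] := @complete_unitmx _ _ _ e (c *m e)^T.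
  by rewrite eE rank_rV trmx_eq0 c0 mxrank_delta.
rewrite eE -rowE => Gc; exists G^T; first by rewrite unitmx_tr.
by rewrite -tr_row -Gc trmxK.
Qed.

Section Wedge.
Variables (R : realType) (n j : nat).
Implicit Types (A : 'M[R]_n) (X : 'M[R]_(n, j)).

Lemma det_rowsub_mul m (f : 'I_j -> 'I_m) (M : 'M[R]_(m, n)) X :
  \det (rowsub f (M *m X)) =
    \sum_(l < wdim n j) \det (mxsub f (ksub_fun (enum_val l)) M) * wedge X l 0.
Proof.
rewrite -mul_rowsub_mx Cauchy_Binet (reindex (@enum_val _ {: ksub n j})) /=.
  by apply: eq_bigr => l _; rewrite mxE -mxsubcr.
exact/onW_bij/enum_val_bij.
Qed.

Lemma wedge_mull A X : wedge (A *m X) = compound j A *m wedge X.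
Proof.
apply/colP => k; rewrite !mxE det_rowsub_mul.
by apply: eq_bigr => l _; rewrite !mxE.
Qed.

Lemma wedge_mulr X (G : 'M[R]_j) : wedge (X *m G) = \det G *: wedge X.
Proof. by apply/colP => k; rewrite !mxE -mul_rowsub_mx det_mulmx mulrC. Qed.

Lemma wedge_eq0 X : (wedge X == 0) = ~~ row_full X.
Proof.
apply/eqP/idP => [X0|/row_full_unit_rowsubP nX].
  apply/row_full_unit_rowsubP => -[f]; rewrite unitmxE unitfE.
  rewrite -[X]mul1mx det_rowsub_mul big1 ?eqxx // => l _.
  by rewrite X0 mxE mulr0.
apply/colP => k; rewrite !mxE; apply/eqP; apply: contra_notT nX => k0.
exists (finfun (ksub_fun (enum_val k))); rewrite unitmxE unitfE.
by congr (\det _ != 0): k0; apply/matrixP => i l; rewrite !mxE ffunE.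
Qed.

Lemma wedge_delta (k : 'I_(wdim n j)) :
  wedge (colsub (ksub_fun (enum_val k)) 1%:M) = delta_mx k 0 :> 'cV[R]__.
Proof.
apply/colP => l; rewrite !mxE eqxx andbT; case: eqP => [->|/eqP lk].
  rewrite (_ : rowsub _ _ = 1%:M) ?det1 //; apply/matrixP => i i'.
  by rewrite !mxE (inj_eq (@ksub_fun_inj _ _ _)).
have /subsetPn[_ /mem_ksubP[i ->] ik] :
    ~~ (val (enum_val l) \subset val (enum_val k)).
  apply: contraNN lk => lk; rewrite -(inj_eq enum_val_inj) -val_eqE eqEcard lk.
  by rewrite (eqP (valP (enum_val l))) (eqP (valP (enum_val k))) leqnn.
rewrite (expand_det_row _ i) big1 // => i' _; rewrite !mxE.
by case: eqP ik => [-> /mem_ksubP[]|_]; [exists i'|rewrite mul0r].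
Qed.
End Wedge.

(** * Topology of matrices *)

Lemma mx_coord_continuous (U : topologicalType) m n i j :
  continuous (fun M : 'M[U]_(m, n) => M i j).
Proof.
move=> M V VM; exists (fun i' j' => if (i' == i) && (j' == j) then V else setT).
  by move=> i' j'; case: andP => [[/eqP-> /eqP->]|_] //; apply: filterT.
by move=> N /(_ i j); rewrite !eqxx.
Qed.

Lemma continuous_mxP (T U : topologicalType) m n (f : T -> 'M[U]_(m, n)) :
  continuous f <-> forall i j, continuous (fun x => f x i j).
Proof.
split=> [f_cont i j x|f_cont x V [P /= P_nbhs PV]].
  apply: (@continuous_comp _ _ _ f (fun M : 'M[U]_(m, n) => M i j)).
    exact: f_cont.
  exact: mx_coord_continuous.
have : \forall y \near x, forall ij : 'I_m * 'I_n, P ij.1 ij.2 (f y ij.1 ij.2).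
  by apply: filter_forall => -[i j]; apply: f_cont; apply: P_nbhs.
by apply: filterS => y Py; apply: PV => i j; apply: (Py (i, j)).
Qed.

Lemma mxsub_continuous (U : topologicalType) m n p q (f : 'I_p -> 'I_m)
  (g : 'I_q -> 'I_n) : continuous (mxsub f g : 'M[U]_(m, n) -> 'M[U]_(p, q)).
Proof.
apply/continuous_mxP => i j; under eq_fun do rewrite mxE.
exact: mx_coord_continuous.
Qed.

Lemma continuous_mulmx (T : topologicalType) (K : numFieldType) m n p
    (f : T -> 'M[K]_(m, n)) (g : T -> 'M[K]_(n, p)) :
  continuous f -> continuous g -> continuous (fun x => f x *m g x).
Proof.
move=> /continuous_mxP f_cont /continuous_mxP g_cont.
apply/continuous_mxP => i j; under eq_fun do rewrite mxE.
apply: continuous_big => [|k _ x]; first exact: add_continuous.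
by apply: cvgM; [exact: (f_cont i k x)|exact: (g_cont k j x)].
Qed.

Lemma det_continuous (K : numFieldType) n : continuous (@determinant K n).
Proof.
apply: continuous_big => [|s _ M]; first exact: add_continuous.
apply: (@continuousM _ _ (fun=> (-1) ^+ s)); first exact: cst_continuous.
apply: (continuous_big (@mul_continuous K)) => i _.
exact: mx_coord_continuous.
Qed.

Lemma wedge_continuous (R : realType) n j : continuous (@wedge R n j).
Proof.
apply/continuous_mxP => k l; under eq_fun do rewrite mxE.
move=> X; apply: (@continuous_comp _ _ _ (rowsub _) (@determinant R j)).
  exact: mxsub_continuous.
exact: det_continuous.
Qed.

Lemma mx_compact (T : ptopologicalType) m n (A : 'I_m -> 'I_n -> set T) :
  (forall i j, compact (A i j)) ->
  compact [set M : 'M[T]_(m, n) | forall i j, A i j (M i j)].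
Proof.
move=> A_compact.
pose vecA k :=
  let ij := enum_val (cast_ord (esym (mxvec_cast m n)) k) in A ij.1 ij.2.
have vecAE i j : vecA (mxvec_index i j) = A i j.
  by rewrite /vecA /mxvec_index cast_ordK enum_rankK.
have vec_mx_cont : continuous (@vec_mx T m n).
  apply/continuous_mxP => i j; under eq_fun do rewrite mxE.
  exact: mx_coord_continuous.
have vecA_compact := @rV_compact T _ vecA (fun=> A_compact _ _).
rewrite [X in compact X](_ : _ =
    vec_mx @` [set v : 'rV[T]_(m * n) | forall k, vecA k (v ord0 k)]).
  exact: continuous_compact (continuous_subspaceT vec_mx_cont) vecA_compact.
apply/seteqP; split=> [M AM|_ [v vecAv <-] i j]; last by rewrite mxE -vecAE.
exists (mxvec M); last exact: mxvecK.
by move=> k; case/mxvec_indexP: k => i j; rewrite vecAE mxvecE.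
Qed.

Lemma mx_norm_leP (K : realDomainType) m n (M : 'M[K]_(m, n)) (a : K) :
  0 <= a -> reflect (forall i j, `|M i j| <= a) (`|M| <= a).
Proof.
move=> a0; rewrite [`|M|]mx_normrE; apply: (iffP (bigmax_leP _ _ _ _)).
  by move=> [_ Ma] i j; apply: (Ma (i, j)).
by move=> Ma; split=> // -[i j] _; apply: Ma.
Qed.

Lemma mx_norm_ball_compact (R : realType) m n (a : R) :
  0 <= a -> compact [set M : 'M[R]_(m, n) | `|M| <= a].
Proof.
move=> a0; rewrite [X in compact X](_ : _ =
    [set M : 'M[R]_(m, n) | forall i j, `[- a, a]%classic (M i j)]).
  apply: (@mx_compact R _ _ (fun _ _ => `[- a, a]%classic)) => i j.
  exact: segment_compact.
apply/seteqP; split=> M /=.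
  by move=> /(mx_norm_leP _ a0) Ma i j; rewrite in_itv /= -ler_norml.
move=> Ma; apply/(mx_norm_leP _ a0) => i j.
by have := Ma i j; rewrite in_itv /= -ler_norml.
Qed.

Lemma closed_equalizer (T U : topologicalType) (f g : T -> U) :
  hausdorff_space U -> continuous f -> continuous g ->
  closed [set x | f x = g x].
Proof.
move=> hU f_cont g_cont x clx; apply: hU => A B fxA gxB.
have fgAB : nbhs x (f @^-1` A `&` g @^-1` B).
  by apply: filterI; [exact: f_cont|exact: g_cont].
have [y [/= fgy [fyA gyB]]] := clx _ fgAB.
by exists (f y); split=> //; rewrite fgy.
Qed.

Lemma closed_compact_projection (T U : topologicalType) (Q : set T)
    (P : set (T * U)) :
  compact Q -> closed P -> closed [set y | exists2 x, Q x & P (x, y)].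
Proof.
move=> /compact_near_coveringP Q_cover P_closed.
rewrite -openC openE => y notPy.
suff : \forall y' \near y, Q `<=` [set x | ~ P (x, y')].
  by apply: filterS => y' QP [x /QP].
apply: Q_cover => x Qx.
have : nbhs (x, y) (~` P).
  apply: open_nbhs_nbhs; split; first exact: closed_openC.
  by move=> Pxy; apply: notPy; exists x.
by apply: filterS => -[].
Qed.

(** * Cones *)

Section SymmetricHull.
Variables (R : realType) (m : nat).
Implicit Types (U : set 'cV[R]_m) (x : 'cV[R]_m).

Lemma neg_setE U : neg_set U = -%R @^-1` U.
Proof.
apply/seteqP; split=> [_ [x Ux <-]|x Ux] /=; first by rewrite opprK.
by exists (- x); rewrite ?opprK.
Qed.

Definition sym_set U : set 'cV[R]_m := U `|` neg_set U.

Lemma sym_setE U x : sym_set U x = (U x \/ U (- x)).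
Proof. by rewrite /sym_set neg_setE. Qed.

Lemma sym_setN U x : sym_set U (- x) = sym_set U x.
Proof. by rewrite !sym_setE opprK orC. Qed.

Lemma sym_set_signr U x k : sym_set U ((-1) ^+ k *: x) = sym_set U x.
Proof.
by rewrite -signr_odd; case: odd; rewrite ?scaleN1r ?sym_setN ?scale1r.
Qed.

Lemma closed_sym_set U : closed U -> closed (sym_set U).
Proof.
move=> U_closed; apply: closedU; rewrite ?neg_setE //.
by apply: preimage_closed => // x _; apply: opp_continuous.
Qed.

Lemma open_sym_set U : open U -> open (sym_set U).
Proof.
move=> U_open; apply: openU; rewrite ?neg_setE //.
by apply: open_comp => // x _; apply: opp_continuous.
Qed.

Lemma interior_neg_set U : interior (neg_set U) = neg_set (interior U).
Proof.
have nbhs_opp V x : nbhs (- x) V -> nbhs x (-%R @^-1` V).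
  exact: opp_continuous.
rewrite !neg_setE; apply/seteqP; split=> x; last exact: nbhs_opp.
rewrite -{1}[x]opprK => /nbhs_opp; apply: filterS => y.
by rewrite /= opprK.
Qed.

Lemma sym_set_interior U :
  sym_set (interior U) = interior U `|` interior (neg_set U).
Proof. by rewrite interior_neg_set. Qed.
End SymmetricHull.

Section ClosedConvexCone.
Variables (R : realType) (m : nat) (K : set 'cV[R]_m).
Hypothesis K_cone : closed_convex_cone K.
Implicit Types (u v x y : 'cV[R]_m) (a t : R).

Lemma coneD x y : K x -> K y -> K (x + y).
Proof. by case: K_cone => _ _ + _; apply. Qed.

Lemma coneZ a x : 0 <= a -> K x -> K (a *: x).
Proof. by case: K_cone => _ _ _; apply. Qed.

Lemma cone0 : K 0.
Proof. by case: K_cone. Qed.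

Lemma cone_closed : closed K.
Proof. by case: K_cone. Qed.

Lemma sym_coneZ a x : sym_set K x -> sym_set K (a *: x).
Proof.
rewrite [a]numEsign -scalerA sym_set_signr !sym_setE -scalerN.
by case=> /(coneZ (normr_ge0 a)); [left|right].
Qed.

Lemma interior_coneZ a x : 0 < a -> interior K x -> interior K (a *: x).
Proof.
move=> a0 Kx; have scale_cont : {for a *: x, continuous (fun y => a^-1 *: y)}.
  exact: scaler_continuous.
have : nbhs (a *: x) [set y | K (a^-1 *: y)].
  by apply: scale_cont; rewrite scalerA mulVf ?gt_eqF ?scale1r.
apply: filterS => y /(coneZ (ltW a0)).
by rewrite scalerA divff ?gt_eqF ?scale1r.
Qed.

(* [-u <= v <= u] in the order whose positive cone is [K]. *)
Definition dominated u v := K (u - v) /\ K (u + v).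

Lemma dominatedN u v : dominated u v -> dominated u (- v).
Proof. by case=> Kuv Kvu; split; rewrite ?opprK. Qed.

Lemma dominatedZ a u v : dominated u v -> dominated (`|a| *: u) (a *: v).
Proof.
move=> [Kuv Kvu].
have dominated_ge0Z b : 0 <= b -> dominated (b *: u) (b *: v).
  by move=> b0; rewrite /dominated -scalerBr -scalerDr; split; apply: coneZ.
have [a0|/ltW a0] := leP 0 a.
  by rewrite ger0_norm //; apply: dominated_ge0Z.
rewrite ler0_norm // -[a *: v]opprK -scaleNr.
by apply/dominatedN/dominated_ge0Z; rewrite oppr_ge0.
Qed.

Lemma dominated_sum (I : finType) (u v : I -> 'cV[R]_m) :
  (forall i, dominated (u i) (v i)) -> dominated (\sum_i u i) (\sum_i v i).
Proof.
move=> uv; elim/big_ind2: _ => [|u1 v1 u2 v2 [? ?] [? ?]|//].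
  by split; rewrite ?subr0 ?addr0; apply: cone0.
by split; rewrite ?opprD addrACA; apply: coneD.
Qed.

Lemma near0_interior u v : interior K u -> \forall e \near 0^'+, K (u + e *: v).
Proof.
move=> Ku; have line_cont : continuous (fun e : R => u + e *: v).
  move=> e; apply: cvgD; first exact: cvg_cst.
  by apply: cvgZ; [exact: cvg_id|exact: cvg_cst].
apply: cvg_within; apply: line_cont.
by rewrite scale0r addr0.
Qed.

Lemma interior_dominates u v : interior K u -> exists t, dominated (t *: u) v.
Proof.
move=> Ku; near (0 : R)^'+ => e.
have e0 : 0 < e by near: e; apply: nbhs_right_gt.
have eV : 0 <= e^-1 by rewrite invr_ge0 ltW.
have scale (w : 'cV[R]_m) : e^-1 *: (u + e *: w) = e^-1 *: u + w.
  by rewrite scalerDr scalerA mulVf ?gt_eqF ?scale1r.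
exists e^-1; split; rewrite -scale; apply: coneZ => //; near: e;
  exact: near0_interior.
Unshelve. all: by end_near. Qed.
End ClosedConvexCone.

Section ProperCone.
Variables (R : realType) (m : nat) (K : set 'cV[R]_m).
Hypothesis K_proper : proper_cone K.

Lemma proper_cone_closed_convex : closed_convex_cone K.
Proof. by case: K_proper. Qed.

Lemma cone_pointed x : K x -> K (- x) -> x = 0.
Proof.
move=> Kx KNx; case: K_proper => _ + _ => /seteqP [+ _].
by apply; split => //; exists (- x); rewrite ?opprK.
Qed.

Lemma interior_cone_neq0 x : (0 < m)%N -> interior K x -> x != 0.
Proof.
move=> m0 Kx; apply/eqP => x0; move: Kx; rewrite x0.
move=> /(interior_dominates proper_cone_closed_convex (const_mx 1))[t].
rewrite /dominated scaler0 !add0r => -[KN1 K1].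
have /matrixP/(_ (Ordinal m0) 0) := cone_pointed K1 KN1.
by rewrite !mxE => /eqP; rewrite oner_eq0.
Qed.

Lemma sym_interior_cone_sub :
  (0 < m)%N -> sym_set (interior K) `<=` sym_set K `\ 0.
Proof.
move=> m0 x; rewrite sym_setE => Kx; split.
  by rewrite sym_setE; case: Kx => /interior_subset; [left|right].
by apply/eqP; case: Kx => /(interior_cone_neq0 m0); rewrite ?oppr_eq0.
Qed.
End ProperCone.

(** * Positive operators *)

Section PositiveOperator.
Variables (R : realType) (m : nat) (K : set 'cV[R]_m) (B : 'M[R]_m).
Hypothesis B_pos : K_positive B K.
Implicit Types (u v x y : 'cV[R]_m).

Lemma K_positive_sym_set x :
  sym_set K x -> x != 0 -> sym_set (interior K) (B *m x).
Proof.
rewrite !sym_setE => -[] Kx x0; [left|right]; first exact: B_pos.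
by rewrite -mulmxN; apply: B_pos; rewrite ?oppr_eq0.
Qed.

Definition unit_nonascending_pairs : set ('cV[R]_m * 'cV[R]_m) :=
  [set z | [/\ K z.1, K z.2, ~ interior K (B *m (z.2 - z.1)) & `|z| = 1]].

Lemma unit_nonascending_pairs_compact :
  closed K -> compact unit_nonascending_pairs.
Proof.
move=> K_closed; pose ball1 := [set x : 'cV[R]_m | `|x| <= 1].
have ball1_compact : compact ball1 by apply: mx_norm_ball_compact.
have balls_compact := compact_setX ball1_compact ball1_compact.
apply: subclosed_compact balls_compact _; last first.
  move=> [x y] [_ _ _ xy1]; have : `|(x, y)| <= 1 by rewrite xy1.
  by rewrite prod_normE ge_max => /andP.
have image_cont : continuous (fun z : 'cV[R]_m * 'cV[R]_m => B *m (z.2 - z.1)).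
  apply: continuous_mulmx => z; first exact: cvg_cst.
  by apply: cvgB; [exact: cvg_snd|exact: cvg_fst].
rewrite (_ : unit_nonascending_pairs = fst @^-1` K `&` (snd @^-1` K `&`
  ((fun z => B *m (z.2 - z.1)) @^-1` (~` interior K) `&`
   (fun z => `|z|) @^-1` [set 1]))).
  apply: closedI; first by apply: preimage_closed => // z _; apply: cvg_fst.
  apply: closedI; first by apply: preimage_closed => // z _; apply: cvg_snd.
  apply: closedI; apply: preimage_closed.
  - by move=> z _; apply: image_cont.
  - exact/open_closedC/open_interior.
  - by move=> z _; apply: norm_continuous.
  - exact: closed_eq.
by apply/seteqP; split=> z /=; [case|move=> [? [? []]]].
Qed.

Lemma near_K_positive_subZ x y : K x -> x != 0 ->
  \forall z \near (x, y) & e \near 0, K (B *m z.1 - e *: (B *m z.2)).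
Proof.
move=> Kx x0; pose diff (ze : ('cV[R]_m * 'cV[R]_m) * R) :=
  B *m ze.1.1 - ze.2 *: (B *m ze.1.2).
have diff_cont : continuous diff.
  have image_cont (f : 'cV[R]_m * 'cV[R]_m -> 'cV[R]_m) : continuous f ->
      continuous (fun ze : ('cV[R]_m * 'cV[R]_m) * R => B *m f ze.1).
    move=> f_cont; apply: continuous_mulmx => ze; first exact: cvg_cst.
    by apply: (@continuous_comp _ _ _ fst f); [exact: cvg_fst|exact: f_cont].
  move=> ze; apply: cvgB; first by apply: (image_cont fst) => z; exact: cvg_fst.
  apply: cvgZ; first exact: cvg_snd.
  by apply: (image_cont snd) => z; exact: cvg_snd.
by apply: (diff_cont ((x, y), 0)); rewrite /diff /= scale0r subr0; apply: B_pos.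
Qed.

Hypothesis K_cone : closed_convex_cone K.

(* By homogeneity [(x, y)] may be taken in a compact set.  There [x] is nonzero,
   as otherwise [B *m (y - x)] would be interior; so [B *m x] is interior. *)
Lemma K_positive_comparison : exists2 e : R, 0 < e &
  forall x y, K x -> K y -> ~ interior K (B *m (y - x)) ->
    K (B *m x - e *: (B *m y)).
Proof.
have /compact_near_coveringP cover :=
  unit_nonascending_pairs_compact (cone_closed K_cone).
have near0_K : \forall e \near (0 : R)^'+, unit_nonascending_pairs `<=`
    [set z | K (B *m z.1 - e *: (B *m z.2))].
  apply: cvg_within.
  apply: (cover R (nbhs (0 : R)) (fun e z => K (B *m z.1 - e *: (B *m z.2))) _).
  move=> [x y] [/= Kx Ky nBxy xy1].
  apply: near_K_positive_subZ Kx _; apply: contra_not_neq nBxy => x0.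
  rewrite x0 subr0; apply: B_pos => //; apply: contra_eq_neq xy1 => y0.
  by rewrite x0 y0 prod_normE normr0 maxxx eq_sym oner_eq0.
near (0 : R)^'+ => e; exists e => [|x y Kx Ky nBxy].
  by near: e; apply: nbhs_right_gt.
have [xy0|xy0] := eqVneq `|(x, y)| 0.
  have /eqP := xy0; rewrite normr_eq0 => /eqP[-> ->].
  by rewrite mulmx0 scaler0 subr0; apply: cone0.
have scale_pos : 0 < `|(x, y)| by rewrite lt0r xy0 normr_ge0.
set r := `|(x, y)| in xy0 scale_pos.
have xy_unit : unit_nonascending_pairs (r^-1 *: (x, y)).
  split=> /=; try by apply: coneZ => //; rewrite invr_ge0 ltW.
    rewrite -scalerBr -scalemxAr => /(interior_coneZ K_cone scale_pos).
    by rewrite scalerA divff ?scale1r.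
  by rewrite normrZ normfV gtr0_norm // mulVf.
have Kr : K (r^-1 *: (B *m x - e *: (B *m y))).
  have : K (B *m (r^-1 *: x) - e *: (B *m (r^-1 *: y))).
    exact: (near near0_K e _ _ xy_unit).
  by rewrite -!scalemxAr scalerA mulrC -scalerA -scalerBr.
by have := coneZ K_cone (ltW scale_pos) Kr; rewrite scalerA divff ?scale1r.
Unshelve. all: by end_near. Qed.

Lemma K_positive_contraction : exists2 q : R, `|q| < 1 &
  forall u v, dominated K u v -> ~ sym_set (interior K) (B *m v) ->
    dominated K (q *: (B *m u)) (B *m v).
Proof.
have [e e0 comparison] := K_positive_comparison.
pose q := (1 - e) / (1 + e); have e1 : 0 < 1 + e by rewrite addr_gt0.
have one_sided u v : dominated K u v -> ~ interior K (B *m v) ->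
    K (q *: (B *m u) - B *m v).
  move=> [Kuv Kvu] nBv; have half0 : 0 <= 2^-1 :> R by rewrite invr_ge0.
  have -> : q *: (B *m u) - B *m v = (2 / (1 + e)) *:
      (B *m (2^-1 *: (u - v)) - e *: (B *m (2^-1 *: (u + v)))).
    rewrite -!scalemxAr mulmxBr mulmxDr; apply/colP => i; rewrite !mxE /q.
    by field; rewrite gt_eqF.
  apply: coneZ => //; first by rewrite divr_ge0 // ltW.
  apply: comparison; try exact: coneZ.
  suff -> : 2^-1 *: (u + v) - 2^-1 *: (u - v) = v by [].
  by apply/colP => i; rewrite !mxE; field.
exists q => [|u v uv].
  rewrite normrM normfV [`|1 + e|]gtr0_norm // ltr_pdivrMr // mul1r ltr_norml.
  by lra.
rewrite sym_setE => /not_orP[nBv nBNv]; split; first exact: one_sided.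
rewrite -[B *m v]opprK -mulmxN; apply: one_sided; first exact: dominatedN.
by rewrite mulmxN.
Qed.
End PositiveOperator.

Lemma iter_mulmx_sum (R : comNzRingType) m (B : 'M[R]_m) (I : finType)
    (a : I -> R) (d : I -> 'cV[R]_m) N :
  iter N (mulmx B) (\sum_i a i *: d i) =
    \sum_i a i *: iter N (mulmx B) (d i).
Proof.
elim: N => [//|N IHN]; rewrite iterS IHN mulmx_sumr.
by apply: eq_bigr => i _; rewrite -scalemxAr.
Qed.

Section PositiveOrbit.
Variables (R : realType) (m : nat) (K : set 'cV[R]_m) (B : 'M[R]_m).
Hypotheses (m_gt0 : (0 < m)%N) (K_proper : proper_cone K).
Hypothesis B_pos : K_positive B K.

Lemma iter_mulmx_interior u N : interior K u -> interior K (iter N (mulmx B) u).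
Proof.
move=> Ku; elim: N => [//|N IHN] /=; apply: B_pos; first exact: interior_subset.
exact: interior_cone_neq0 IHN.
Qed.

Lemma K_positive_orbit_meets_interior (I : finType) (a : I -> R)
    (d : I -> 'cV[R]_m) :
  interior K (\sum_i a i *: d i) ->
  exists N i, sym_set (interior K) (iter N (mulmx B) (d i)).
Proof.
set p := \sum_i _ => Kp; apply: contrapT => noN.
have K_cone := proper_cone_closed_convex K_proper.
have [q q1 contraction] := K_positive_contraction B_pos K_cone.
have /all_sig[t tP] i : {t | dominated K (t *: p) (d i)}.
  by apply/cid/interior_dominates.
pose orbit (x : 'cV[R]_m) N := iter N (mulmx B) x.
have orbit_d i N : dominated K ((t i * q ^+ N) *: orbit p N) (orbit (d i) N).
  elim: N => [|N IHN]; first by rewrite mulr1.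
  rewrite exprSr mulrA mulrC -scalerA scalemxAr; apply: contraction => // BdN.
  by apply: noN; exists N.+1, i.
pose M := \sum_i `|a i| * t i.
have orbit_p N : dominated K ((M * q ^+ N) *: orbit p N) (orbit p N).
  rewrite {2}/orbit iter_mulmx_sum mulr_suml scaler_suml.
  by apply: dominated_sum => // i; rewrite -mulrA -scalerA; apply: dominatedZ.
have [N MqN] : exists N, M * q ^+ N < 1.
  have /cvgrPdist_lt/(_ 1 ltr01)[N _ /(_ N (leqnn N))] := cvg_geometric M q1.
  by rewrite /= sub0r normrN => /ltr_normlW; exists N.
have KpN := iter_mulmx_interior N Kp.
have [KMp _] := orbit_p N; have /negP := interior_cone_neq0 K_proper m_gt0 KpN.
apply; apply/eqP/(cone_pointed K_proper); first exact: interior_subset.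
have -> : - orbit p N =
    (1 - M * q ^+ N)^-1 *: ((M * q ^+ N) *: orbit p N - orbit p N).
  move: (orbit p N) => x; apply/colP => i; rewrite !mxE; field.
  by rewrite gt_eqF ?subr_gt0.
by apply: coneZ => //; rewrite invr_ge0 subr_ge0 ltW.
Qed.
End PositiveOrbit.

(** * First columns of decomposable vectors *)

Section WedgeHeads.
Variables (R : realType) (n j : nat).
Implicit Types (x : 'cV[R]_n) (U W : set 'cV[R]_(wdim n j.+1)).

Definition wedge_heads U : set 'cV[R]_n :=
  [set x | exists X : 'M[R]_(n, j.+1), col 0 X = x /\ U (wedge X)].

Lemma open_wedge_heads U : open U -> open (wedge_heads U).
Proof.
move=> U_open; rewrite openE => _ [X [<- UX]].
pose with_col0 (y : 'cV[R]_n) : 'M[R]_(n, j.+1) :=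
  \matrix_(i, k) if k == 0 then y i 0 else X i k.
have with_col0_cont : continuous with_col0.
  apply/continuous_mxP => i k; under eq_fun do rewrite mxE.
  by case: eqP => _; [exact: mx_coord_continuous|exact: cst_continuous].
have with_col0X : with_col0 (col 0 X) = X.
  by apply/matrixP => i k; rewrite !mxE; case: eqP => [->|].
have : nbhs (col 0 X) ((@wedge R n j.+1 \o with_col0) @^-1` U).
  apply: (continuous_comp (with_col0_cont _)); first exact: wedge_continuous.
  by apply: open_nbhs_nbhs; rewrite /= with_col0X.
apply: filterS => y Uy; exists (with_col0 y); split=> //.
by apply/colP => i; rewrite !mxE.
Qed.

(* Since [rowsub f Y = 1%:M], the equation [Y *m rowsub f x = x] below says that
   [x] is a linear combination of the columns of [Y]. *)
Definition pivot_frames W (f : {ffun 'I_j.+1 -> 'I_n}) : set 'M[R]_(n, j.+1) :=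
  [set Y | [/\ rowsub f Y = 1%:M, `|Y| <= 1 & W (wedge Y)]].

Definition pivot_span W f : set 'cV[R]_n :=
  [set x | exists2 Y, pivot_frames W f Y & Y *m rowsub f x = x].

Lemma pivot_frames_compact W f : closed W -> compact (pivot_frames W f).
Proof.
move=> W_closed.
have ball1_compact := @mx_norm_ball_compact R n j.+1 1 ler01.
apply: subclosed_compact ball1_compact _; last by move=> Y [].
rewrite (_ : pivot_frames W f = [set Y | rowsub f Y = 1%:M] `&`
  ([set Y | `|Y| <= 1] `&` @wedge R n j.+1 @^-1` W)).
  apply: closedI; last apply: closedI.
  - apply: closed_equalizer; first exact: norm_hausdorff.
      exact: mxsub_continuous.
    exact: cst_continuous.
  - apply: compact_closed; first exact: norm_hausdorff.
    exact: mx_norm_ball_compact.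
  - by apply: preimage_closed => // Y _; apply: wedge_continuous.
by apply/seteqP; split=> Y /=; [case|move=> [? []]].
Qed.

Lemma closed_pivot_span W f : closed W -> closed (pivot_span W f).
Proof.
move=> W_closed.
have eq_closed : closed [set Yx : 'M[R]_(n, j.+1) * 'cV[R]_n |
    Yx.1 *m rowsub f Yx.2 = Yx.2]; last first.
  exact: closed_compact_projection (pivot_frames_compact W_closed) eq_closed.
apply: closed_equalizer; first exact: norm_hausdorff.
  apply: continuous_mulmx => Yx; first exact: cvg_fst.
  apply: (@continuous_comp _ _ _ snd (rowsub f)); first exact: cvg_snd.
  exact: mxsub_continuous.
by move=> Yx; apply: cvg_snd.
Qed.

Lemma pivot_span_wedge_heads W f x : (forall a w, W w -> W (a *: w)) ->
  pivot_span W f x -> x != 0 -> wedge_heads (W `\ 0) x.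
Proof.
move=> W_scale [Y [Yf _ WY] xE] x0.
have [|G G_unit Gx] := @exists_unitmx_col0 _ _ (rowsub f x).
  by apply: contraNneq x0 => fx0; rewrite -xE fx0 mulmx0.
exists (Y *m G); split; first by rewrite colE -mulmxA -colE Gx.
split=> /=; first by rewrite wedge_mulr; apply: W_scale.
apply/eqP; rewrite wedge_mulr scaler_eq0 negb_or -unitfE -unitmxE G_unit /=.
rewrite wedge_eq0 negbK; apply/row_full_unit_rowsubP.
by exists f; rewrite Yf unitmx1.
Qed.

Lemma wedge_heads_pivot_span W x : (forall a w, W w -> W (a *: w)) ->
  wedge_heads (W `\ 0) x -> exists f, pivot_span W f x.
Proof.
move=> W_scale [X [<- [WX /eqP]]]; rewrite wedge_eq0 negbK.
move=> /maximal_minor_bound[f f_unit X_le1].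
exists f, (X *m invmx (rowsub f X)).
  split; first by rewrite -mul_rowsub_mx mulmxV.
    exact/mx_norm_leP.
  by rewrite wedge_mulr; apply: W_scale.
by rewrite colE -mul_rowsub_mx -mulmxA mulKmx.
Qed.

Lemma closure_wedge_heads W : closed W -> (forall a w, W w -> W (a *: w)) ->
  closure (wedge_heads (W `\ 0)) `\ 0 `<=` wedge_heads (W `\ 0).
Proof.
move=> W_closed W_scale x [clx /eqP x0].
have : closure (\bigcup_f pivot_span W f) x.
  apply: closureS clx => y /(wedge_heads_pivot_span W_scale)[f Wfy].
  by exists f.
rewrite -(closure_id _).1 => [[f _ Wfx]|].
  exact: pivot_span_wedge_heads Wfx x0.
apply: closed_bigcup => [|f _]; first exact: finite_finset.
exact: closed_pivot_span.
Qed.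
End WedgeHeads.

Lemma col0_cV (T : Type) n (x : 'cV[T]_n) : col 0 x = x.
Proof. by apply/matrixP => i k; rewrite mxE ord1. Qed.

Section TK.
Variables (R : realType) (n : nat).

Lemma wedge_heads_sub_TK j (K : set 'cV[R]_(wdim n j.+1)) :
  wedge_heads (sym_set (interior K)) `<=` TK K.
Proof.
rewrite sym_set_interior; case: j K => [|j] K; last exact: subset_closure.
move=> _ [X [<- KX]]; rewrite col0_cV.
by case: KX => /interior_subset; [left|right].
Qed.

Lemma TK_sub_wedge_heads j (K : set 'cV[R]_(wdim n j.+1)) :
  (j < n)%N -> proper_cone K -> TK K `\ 0 `<=` wedge_heads (sym_set K `\ 0).
Proof.
case: j K => [|j] K jn K_proper x [Kx /eqP x0].
  exists x; rewrite col0_cV; split=> //; split=> //; apply/eqP.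
  by rewrite wedge_eq0 negbK -col_leq_rank lt0n mxrank_eq0.
have K_cone := proper_cone_closed_convex K_proper.
apply: closure_wedge_heads.
- exact: closed_sym_set (cone_closed K_cone).
- by move=> a w; apply: sym_coneZ.
split; last exact/eqP; apply: closureS Kx => y [X [Xy KX]].
exists X; split=> //; apply: (sym_interior_cone_sub K_proper (wdim_gt0 jn)).
by rewrite sym_set_interior.
Qed.

Variable A : 'M[R]_n.

Lemma iter_scale_compound k j (a : R) (X : 'M[R]_(n, j)) :
  iter k (mulmx (a *: compound j A)) (wedge X) =
    a ^+ k *: wedge (iter k (mulmx A) X).
Proof.
elim: k => [|k IHk]; first by rewrite scale1r.
by rewrite !iterS IHk -scalemxAl -scalemxAr scalerA -exprS wedge_mull.
Qed.

Lemma wedge_heads_nonempty j (K : set 'cV[R]_(wdim n j.+1)) (b : bool) :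
  (j < n)%N -> proper_cone K -> K_positive ((-1) ^+ b *: compound j.+1 A) K ->
  wedge_heads (sym_set (interior K)) !=set0.
Proof.
move=> jn K_proper A_pos; have [p Kp] : interior K !=set0 by case: K_proper.
pose basis (k : 'I_(wdim n j.+1)) : 'M[R]_(n, j.+1) :=
  colsub (ksub_fun (enum_val k)) 1%:M.
have pE : p = \sum_k p k 0 *: wedge (basis k).
  rewrite [LHS]matrix_sum_delta; apply: eq_bigr => k _.
  by rewrite big_ord1 wedge_delta.
rewrite pE in Kp.
have [N [k]] := K_positive_orbit_meets_interior (wdim_gt0 jn) K_proper A_pos Kp.
rewrite iter_scale_compound -exprM sym_set_signr => Kk.
by exists (col 0 (iter N (mulmx A) (basis k))); eexists.
Qed.

Lemma mulmx_wedge_heads j (K : set 'cV[R]_(wdim n j.+1)) (b : bool) x :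
  K_positive ((-1) ^+ b *: compound j.+1 A) K ->
  wedge_heads (sym_set K `\ 0) x -> wedge_heads (sym_set (interior K)) (A *m x).
Proof.
move=> A_pos [X [<- [KX /eqP X0]]].
exists (A *m X); split; first by rewrite !colE mulmxA.
rewrite -(sym_set_signr _ _ b) wedge_mull scalemxAl.
exact: K_positive_sym_set A_pos _ KX X0.
Qed.
End TK.

Theorem theorem25 (R : realType) (n : nat) (A : 'M[R]_n)
  (K : forall j : nat, set 'cV[R]_(wdim n j)) :
  TP_structure K -> GSSR A K ->
  forall j : nat, (1 <= j <= n)%N ->
    interior (TK (K j)) !=set0 /\
    (forall x : 'cV[R]_n, TK (K j) x -> x != 0 -> interior (TK (K j)) (A *m x)).
Proof.
move=> K_TP [eps A_GSSR] [//|j] jn; have K_proper := K_TP _ jn.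
have [b A_pos] : exists b : bool,
    K_positive ((-1) ^+ b *: compound j.+1 A) (K j.+1).
  have [[->|->] A_pos] := A_GSSR _ jn; [exists false|exists true].
    by rewrite expr0.
  by rewrite expr1.
have heads_interior :
    wedge_heads (sym_set (interior (K j.+1))) `<=` interior (TK (K j.+1)).
  rewrite -open_subsetE; first exact: wedge_heads_sub_TK.
  exact/open_wedge_heads/open_sym_set/open_interior.
split.
  have [x x_head] := wedge_heads_nonempty jn K_proper A_pos.
  by exists x; apply: heads_interior.
move=> x Kx /eqP x0; apply: heads_interior; apply: mulmx_wedge_heads A_pos _.
exact: TK_sub_wedge_heads.
Qed.
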